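(* Let $A/S$ be a Frobenius extension of rings and let $M$ be a right $A$-module. Then $M$ is Gorenstein projective as a right $A$-module if and only if its underlying right $S$-module $M_S$ (obtained by restriction of scalars along $l$) is Gorenstein projective as a right $S$-module.
   Context: All rings are associative with identity and modules are unital right modules. A ring extension $A/S$ is a ring homomorphism $l\colon S\to A$; $A$ becomes an $S$-$S$-bimodule, an $A$-$S$-bimodule, etc. via $s\cdot a\cdot s' = l(s)\,a\,l(s')$, and a right $A$-module $M$ becomes a right $S$-module $M_S$ via $m\cdot s = m\,l(s)$. The ring extension $A/S$ is a Frobenius extension if $A_S$ is finitely generated projective and ${}_SA_A\cong \mathrm{Hom}_S({}_AA_S,{}_SS_S)$ as $S$-$A$-bimodules; equivalently, there exist an $S$-$S$-bimodule map $E\colon A\to S$ and finitely many elements $x_i,y_i\in A$ such that $\sum_i x_iE(y_ia)=a$ and $\sum_i E(ax_i)y_i=a$ for all $a\in A$. A right $A$-module $G$ is Gorenstein projective if there is an exact complex of projective right $A$-modules $\cdots\to P_1\to P_0\to P^0\to P^1\to\cdots$ which remains exact after applying $\mathrm{Hom}_A(-,Q)$ for every projective right $A$-module $Q$, and with $G\cong\mathrm{Ker}(P^0\to P^1)=\mathrm{Im}(P_0\to P^0)$. *)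

(* Defs.v *)
From HB Require Import structures.
From mathcomp Require Import all_boot all_order all_algebra.
Set Implicit Arguments. Unset Strict Implicit. Unset Printing Implicit Defensive.
Import Order.TTheory GRing.Theory Num.Theory.
Local Open Scope ring_scope.

Record rmodule (R : pzRingType) := RModule {
  rm_car :> zmodType;
  rm_act : rm_car -> R -> rm_car;
  rm_act1 : forall m, rm_act m 1 = m;
  rm_actM : forall m r s, rm_act m (r * s) = rm_act (rm_act m r) s;
  rm_actDl : forall m n r, rm_act (m + n) r = rm_act m r + rm_act n r;
  rm_actDr : forall m r s, rm_act m (r + s) = rm_act m r + rm_act m s }.

Arguments rm_act {R} r0 _ _.

Definition is_rhom (R : pzRingType) (M N : rmodule R) (f : M -> N) : Prop :=
  (forall x y : M, f (x + y) = f x + f y) /\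
  (forall (m : M) (r : R), f (rm_act M m r) = rm_act N (f m) r).

Definition projective (R : pzRingType) (P : rmodule R) : Prop :=
  forall (N N' : rmodule R) (g : N -> N') (f : P -> N'),
    is_rhom g -> (forall y : N', exists x : N, g x = y) -> is_rhom f ->
    exists h : P -> N, is_rhom h /\ forall x : P, g (h x) = f x.

(* Gorenstein projective right R-module G: there is a complex
   ... -> P(-1) -> P(0) -> P(1) -> ... of projective modules, indexed by int,
   with differentials d i : P i -> P (i+1), which is exact, stays exact under
   Hom_R(-, Q) for every projective Q, and with G isomorphic to Ker(d 0)
   (here P(-1) = P_0, P(0) = P^0, P(1) = P^1 in the paper's notation). *)
Definition gorenstein_projective (R : pzRingType) (G : rmodule R) : Prop :=
  exists (P : int -> rmodule R) (d : forall i : int, P i -> P (i + 1)),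
    (forall i, projective (P i)) /\
    (forall i, is_rhom (d i)) /\
    (forall (i : int) (y : P (i + 1)),
        d (i + 1) y = 0 <-> exists x : P i, d i x = y) /\
    (forall (Q : rmodule R), projective Q ->
       forall (i : int) (f : P (i + 1) -> Q), is_rhom f ->
         (forall x : P i, f (d i x) = 0) ->
         exists g : P (i + 1 + 1) -> Q, is_rhom g /\
           forall y : P (i + 1), g (d (i + 1) y) = f y) /\
    (exists iota : G -> P 0, is_rhom iota /\ injective iota /\
       forall y : P 0, d 0 y = 0 <-> exists x : G, iota x = y).

Section Restriction.
Variables (S A : pzRingType) (l : {rmorphism S -> A}) (M : rmodule A).

Definition restr_act (m : M) (s : S) : M := rm_act M m (l s).

Lemma restr_act1 m : restr_act m 1 = m.
Proof. by rewrite /restr_act rmorph1 rm_act1. Qed.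
Lemma restr_actM m r s : restr_act m (r * s) = restr_act (restr_act m r) s.
Proof. by rewrite /restr_act rmorphM rm_actM. Qed.
Lemma restr_actDl m n r : restr_act (m + n) r = restr_act m r + restr_act n r.
Proof. by rewrite /restr_act rm_actDl. Qed.
Lemma restr_actDr m r s : restr_act m (r + s) = restr_act m r + restr_act m s.
Proof. by rewrite /restr_act rmorphD rm_actDr. Qed.

Definition restrict : rmodule S :=
  @RModule S (rm_car M) restr_act restr_act1 restr_actM restr_actDl restr_actDr.
End Restriction.

Definition frobenius_ext (S A : pzRingType) (l : {rmorphism S -> A}) : Prop :=
  exists (E : A -> S) (n : nat) (x y : 'I_n -> A),
    (forall a b : A, E (a + b) = E a + E b) /\
    (forall (s : S) (a : A), E (l s * a) = s * E a) /\
    (forall (s : S) (a : A), E (a * l s) = E a * s) /\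
    (forall a : A, \sum_(i < n) x i * l (E (y i * a)) = a) /\
    (forall a : A, \sum_(i < n) l (E (a * x i)) * y i = a).

(* Main.v *)
(** A module is Gorenstein projective iff it belongs to a class of modules in
    which every member is both the kernel and the cokernel term of a short exact
    sequence with projective middle term and third term in the class, such that
    maps from the kernel to projectives extend to the middle term.

    For a Frobenius extension, coinduction Hom_S(A, -) is both right and left
    adjoint to restriction. Hence restriction and coinduction preserve
    projectives, and restriction carries such a class over A to one over S.

    Conversely, given such a class X over S, take the A-modules W whose
    restriction is a stable retract of some Z in X, i.e. the identity of W is
    v u + b a with v u factoring through Z and b a through a projective P. If
    Z embeds in the projective T, then the S-embedding of W in T (+) P yields an
    A-embedding in the coinduced module, and dually for covers. A Schanuel-type
    argument shows that the new cokernel or kernel is again a stable retract of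
    a member of X. *)

Require Import Defs.
From HB Require Import structures.
From mathcomp Require Import all_boot all_order all_algebra.
From mathcomp Require Import boolp.
Set Implicit Arguments. Unset Strict Implicit. Unset Printing Implicit Defensive.
Import GRing.Theory.
Local Open Scope ring_scope.
Local Open Scope quotient_scope.

(** * Elementary identities for actions and homomorphisms *)

Section Homomorphisms.
Variable R : pzRingType.
Implicit Types M N L : rmodule R.

Lemma act_morph0 M r : rm_act M 0 r = 0.
Proof. by apply: (@addIr _ (rm_act M 0 r)); rewrite -rm_actDl !add0r. Qed.

Lemma act_morphN M m r : rm_act M (- m) r = - rm_act M m r.
Proof. by apply: (@addIr _ (rm_act M m r)); rewrite -rm_actDl !addNr act_morph0. Qed.

Lemma act_suml M (I : finType) (F : I -> M) r :
  rm_act M (\sum_i F i) r = \sum_i rm_act M (F i) r.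
Proof.
exact: (big_morph (fun m => rm_act M m r) (fun x y => rm_actDl x y r)
         (act_morph0 M r)).
Qed.

Lemma act_morph0r M m : rm_act M m 0 = 0.
Proof. by apply: (@addIr _ (rm_act M m 0)); rewrite -rm_actDr !add0r. Qed.

Lemma act_sumr M (I : finType) (F : I -> R) m :
  rm_act M m (\sum_i F i) = \sum_i rm_act M m (F i).
Proof.
exact: (big_morph (rm_act M m) (fun x y => rm_actDr m x y) (act_morph0r m)).
Qed.

Lemma rhom0 M N (f : M -> N) : is_rhom f -> f 0 = 0.
Proof. by case=> fD _; apply: (@addIr _ (f 0)); rewrite -fD !add0r. Qed.

Lemma rhomN M N (f : M -> N) x : is_rhom f -> f (- x) = - f x.
Proof.
by move=> fh; apply: (@addIr _ (f x)); rewrite -fh.1 !addNr (rhom0 fh).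
Qed.

Lemma rhomB M N (f : M -> N) x y : is_rhom f -> f (x - y) = f x - f y.
Proof. by move=> fh; rewrite fh.1 rhomN. Qed.

Lemma rhom_sum M N (f : M -> N) (I : finType) (F : I -> M) :
  is_rhom f -> f (\sum_i F i) = \sum_i f (F i).
Proof. by move=> fh; exact: (big_morph f fh.1 (rhom0 fh)). Qed.

Lemma rhom_inj M N (f : M -> N) :
  is_rhom f -> (forall x, f x = 0 -> x = 0) -> injective f.
Proof.
move=> fh f0 x y e; apply/eqP; rewrite -subr_eq0; apply/eqP/f0.
by rewrite rhomB // e subrr.
Qed.

Lemma rhom_id M : is_rhom (fun x : M => x).
Proof. by []. Qed.

Lemma rhom_zero M N : is_rhom (fun _ : M => 0 : N).
Proof. by split=> *; rewrite ?addr0 ?act_morph0. Qed.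

Lemma rhom_comp M N L (f : M -> N) (g : N -> L) :
  is_rhom f -> is_rhom g -> is_rhom (fun x => g (f x)).
Proof. by move=> [fD fZ] [gD gZ]; split=> *; rewrite (fD, fZ) (gD, gZ). Qed.

Lemma rhom_add M N (f g : M -> N) :
  is_rhom f -> is_rhom g -> is_rhom (fun x => f x + g x).
Proof.
by move=> [fD fZ] [gD gZ]; split=> *; rewrite ?fD ?fZ ?gD ?gZ ?rm_actDl // addrACA.
Qed.

Lemma rhom_sub M N (f g : M -> N) :
  is_rhom f -> is_rhom g -> is_rhom (fun x => f x - g x).
Proof.
move=> fh gh; split=> *; first by rewrite fh.1 gh.1 opprD addrACA.
by rewrite fh.2 gh.2 rm_actDl act_morphN.
Qed.

End Homomorphisms.

(** * Kernels of additive maps as abelian groups *)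

Section KernelZmodule.
Variables (U V : zmodType) (f : U -> V).
Hypothesis fD : forall x y, f (x + y) = f x + f y.

Let f0 : f 0 == 0.
Proof. by apply/eqP/(@addIr _ (f 0)); rewrite -fD !add0r. Qed.

Local Notation K := {x : U | f x == 0}.

Fact ker_addP (x y : K) : f (val x + val y) == 0.
Proof. by rewrite fD (eqP (valP x)) (eqP (valP y)) addr0. Qed.

Fact ker_oppP (x : K) : f (- val x) == 0.
Proof.
by apply/eqP/(@addIr _ (f (val x))); rewrite -fD addNr (eqP f0) (eqP (valP x)) addr0.
Qed.

Let addK (x y : K) : K := exist (fun u => f u == 0) _ (ker_addP x y).
Let oppK (x : K) : K := exist (fun u => f u == 0) _ (ker_oppP x).
Let zeroK : K := exist (fun u => f u == 0) _ f0.

Fact ker_addA : associative addK.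
Proof. by move=> x y z; apply: val_inj; exact: addrA. Qed.
Fact ker_addC : commutative addK.
Proof. by move=> x y; apply: val_inj; exact: addrC. Qed.
Fact ker_add0 : left_id zeroK addK.
Proof. by move=> x; apply: val_inj; exact: add0r. Qed.
Fact ker_addN : left_inverse zeroK oppK addK.
Proof. by move=> x; apply: val_inj; exact: addNr. Qed.

Definition ker_zmod : zmodType :=
  HB.pack K (GRing.isZmodule.Build K ker_addA ker_addC ker_add0 ker_addN).

Definition ker_val (x : ker_zmod) : U := val (x : K).

Lemma ker_val_inj : injective ker_val.
Proof. exact: val_inj. Qed.

Lemma ker_valD x y : ker_val (x + y) = ker_val x + ker_val y.
Proof. by []. Qed.

Lemma ker_valP x : f (ker_val x) = 0.
Proof. exact/eqP/(valP (x : K)). Qed.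

Definition ker_mk (x : U) (fx : f x = 0) : ker_zmod :=
  exist (fun u => f u == 0) x (introT eqP fx).

End KernelZmodule.

(** * Short exact sequences, kernels, quotients and direct sums *)

Section ShortExact.
Variable R : pzRingType.
Implicit Types M N T D K P Q : rmodule R.

Record short_exact M T N (i : M -> T) (p : T -> N) : Prop := ShortExact {
  se_rhomi : is_rhom i;
  se_rhomp : is_rhom p;
  se_inj : injective i;
  se_surj : forall y, exists x, p x = y;
  se_exact : forall x, p x = 0 <-> exists m, i m = x }.

Lemma se_comp0 M T N (i : M -> T) (p : T -> N) m : short_exact i p -> p (i m) = 0.
Proof. by move=> se; apply/(se_exact se); exists m. Qed.

Lemma se_lift M T N (i : M -> T) (p : T -> N) (L : rmodule R) (f : L -> T) :
  short_exact i p -> is_rhom f -> (forall x, p (f x) = 0) ->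
  exists c : L -> M, is_rhom c /\ forall x, i (c x) = f x.
Proof.
move=> se fh pf0.
have /choice [c ic] : forall x, exists m, i m = f x.
  by move=> x; apply/(se_exact se).
exists c; split=> //; split=> *; apply: (se_inj se).
  by rewrite (se_rhomi se).1 !ic fh.1.
by rewrite (se_rhomi se).2 !ic fh.2.
Qed.

Lemma se_descend M T N (i : M -> T) (p : T -> N) (L : rmodule R) (f : T -> L) :
  short_exact i p -> is_rhom f -> (forall m, f (i m) = 0) ->
  exists c : N -> L, is_rhom c /\ forall x, c (p x) = f x.
Proof.
move=> se fh fi0.
(* A set-theoretic section suffices: [f] vanishes on the kernel of [p], so [f x] depends only on
   [p x]. *)
have [s sK] := choice (se_surj se).
have cP x y : p x = p y -> f x = f y.
  move=> e; apply/eqP; rewrite -subr_eq0 -rhomB //; apply/eqP.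
  have /(se_exact se) [m <-] : p (x - y) = 0 by rewrite (rhomB _ _ (se_rhomp se)) e subrr.
  exact: fi0.
exists (fun y => f (s y)); split=> [|x]; last by apply: cP; rewrite sK.
split=> *.
  by rewrite -fh.1; apply: cP; rewrite (se_rhomp se).1 !sK.
by rewrite -fh.2; apply: cP; rewrite (se_rhomp se).2 !sK.
Qed.

Section KernelModule.
Variables (T N : rmodule R) (p : T -> N) (ph : is_rhom p).
Let K := ker_zmod ph.1.

Fact ker_actP (x : K) r : p (rm_act T (ker_val x) r) = 0.
Proof. by rewrite ph.2 ker_valP act_morph0. Qed.

Let actK (x : K) r : K := ker_mk ph.1 (ker_actP x r).

Fact ker_act1 x : actK x 1 = x.
Proof. by apply: ker_val_inj; exact: rm_act1. Qed.
Fact ker_actM x r s : actK x (r * s) = actK (actK x r) s.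
Proof. by apply: ker_val_inj; exact: rm_actM. Qed.
Fact ker_actDl x y r : actK (x + y) r = actK x r + actK y r.
Proof. by apply: ker_val_inj; exact: rm_actDl. Qed.
Fact ker_actDr x r s : actK x (r + s) = actK x r + actK x s.
Proof. by apply: ker_val_inj; exact: rm_actDr. Qed.

Definition ker_mod : rmodule R := RModule ker_act1 ker_actM ker_actDl ker_actDr.
End KernelModule.

Lemma exists_kernel T N (p : T -> N) : is_rhom p -> (forall y, exists x, p x = y) ->
  exists K (i : K -> T), short_exact i p.
Proof.
move=> ph psurj; exists (ker_mod ph), (@ker_val _ _ _ _); split=> //.
  exact: ker_val_inj.
move=> x; split=> [px0|[m <-]]; last exact: ker_valP.
by exists (ker_mk ph.1 px0).
Qed.

Section QuotientModule.
Variables (M T : rmodule R) (i : M -> T) (ih : is_rhom i).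

Let im : {pred T} := fun y => `[< exists x, i x = y >].

Fact im_zmod_closed : zmod_closed im.
Proof.
split; first by apply/asboolP; exists 0; rewrite (rhom0 ih).
move=> _ _ /asboolP[x <-] /asboolP[y <-]; apply/asboolP.
by exists (x - y); rewrite rhomB.
Qed.

Let I : zmodClosed T := HB.pack im (GRing.isZmodClosed.Build T im im_zmod_closed).
Let Q : zmodType := Quotient.quot I.
Let pq (x : T) : Q := \pi_(Quotient.quot I) x.

Fact pqD x y : pq (x + y) = pq x + pq y.
Proof. by rewrite /pq raddfD. Qed.

Fact pq_eq x y : pq x = pq y <-> exists m, i m = x - y.
Proof.
rewrite /pq; split=> [/eqP|]; first by rewrite -Quotient.idealrBE => /asboolP.
by move=> e; apply/eqP; rewrite -Quotient.idealrBE; apply/asboolP.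
Qed.

Fact pq_surj (z : Q) : exists x, pq x = z.
Proof. by exists (repr z); exact: reprK. Qed.

Let actq (z : Q) r : Q := pq (rm_act T (repr z) r).

Fact actqE x r : actq (pq x) r = pq (rm_act T x r).
Proof.
apply/pq_eq; have /pq_eq [m e] : pq (repr (pq x)) = pq x by exact: reprK.
by exists (rm_act M m r); rewrite ih.2 e rm_actDl act_morphN.
Qed.

Fact quot_act1 z : actq z 1 = z.
Proof. by have [x <-] := pq_surj z; rewrite actqE rm_act1. Qed.
Fact quot_actM z r s : actq z (r * s) = actq (actq z r) s.
Proof. by have [x <-] := pq_surj z; rewrite !actqE rm_actM. Qed.
Fact quot_actDl z t r : actq (z + t) r = actq z r + actq t r.
Proof.
have [x <-] := pq_surj z; have [y <-] := pq_surj t.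
by rewrite -pqD !actqE rm_actDl pqD.
Qed.
Fact quot_actDr z r s : actq z (r + s) = actq z r + actq z s.
Proof. by have [x <-] := pq_surj z; rewrite !actqE rm_actDr pqD. Qed.

Let quot_mod : rmodule R := RModule quot_act1 quot_actM quot_actDl quot_actDr.

Lemma exists_cokernel : injective i -> exists N (p : T -> N), short_exact i p.
Proof.
move=> iinj; exists quot_mod, pq; split=> //.
- by split=> [|x r]; [exact: pqD | rewrite /= actqE].
- exact: pq_surj.
have pq0 : pq 0 = 0 :> Q by exact: raddf0.
by move=> x; have := pq_eq x 0; rewrite pq0 subr0.
Qed.
End QuotientModule.

Section DirectSum.
Variables M N : rmodule R.
Let actS (x : M * N) r : M * N := (rm_act M x.1 r, rm_act N x.2 r).

Fact dsum_act1 x : actS x 1 = x.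
Proof. by case: x => a b; rewrite /actS /= !rm_act1. Qed.
Fact dsum_actM x r s : actS x (r * s) = actS (actS x r) s.
Proof. by rewrite /actS /= !rm_actM. Qed.
Fact dsum_actDl x y r : actS (x + y) r = actS x r + actS y r.
Proof. by rewrite /actS /= !rm_actDl. Qed.
Fact dsum_actDr x r s : actS x (r + s) = actS x r + actS x s.
Proof. by rewrite /actS /= !rm_actDr. Qed.

Definition dsum : rmodule R := RModule dsum_act1 dsum_actM dsum_actDl dsum_actDr.

Lemma rhom_pair (L : rmodule R) (f : L -> M) (g : L -> N) :
  is_rhom f -> is_rhom g -> is_rhom (fun x => (f x, g x) : dsum).
Proof. by move=> fh gh; split=> *; rewrite (fh.1, fh.2) (gh.1, gh.2). Qed.

Lemma rhom_copair (L : rmodule R) (f : M -> L) (g : N -> L) :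
  is_rhom f -> is_rhom g -> is_rhom (fun x : dsum => f x.1 + g x.2).
Proof.
move=> fh gh; split=> *; rewrite /= (fh.1, fh.2) (gh.1, gh.2) ?rm_actDl //.
by rewrite addrACA.
Qed.

Lemma projective_dsum : projective M -> projective N -> projective dsum.
Proof.
move=> Mp Np L L' g f gh gsurj fh.
have inl : is_rhom (fun x : M => (x, 0) : dsum).
  by apply: rhom_pair; [exact: rhom_id | exact: rhom_zero].
have inr : is_rhom (fun x : N => (0, x) : dsum).
  by apply: rhom_pair; [exact: rhom_zero | exact: rhom_id].
have [h1 [h1h e1]] := Mp _ _ _ _ gh gsurj (rhom_comp inl fh).
have [h2 [h2h e2]] := Np _ _ _ _ gh gsurj (rhom_comp inr fh).
exists (fun x : dsum => h1 x.1 + h2 x.2); split; first exact: rhom_copair.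
case=> a b; rewrite gh.1 e1 e2 -fh.1; congr f.
by congr pair; rewrite (addr0, add0r).
Qed.
End DirectSum.

(** When [i] is injective with cokernel N and [T] is projective, this says that Ext^1(N, Q) = 0 for
    every projective Q. *)
Definition proj_extendable M T (i : M -> T) : Prop :=
  forall Q, projective Q -> forall f : M -> Q, is_rhom f ->
    exists g : T -> Q, is_rhom g /\ forall m, g (i m) = f m.

(** Data rather than a proposition, so that a family of steps indexed by [int] can be fixed and
    spliced. *)
Record gp_step M N := GPStep {
  gs_mid : rmodule R;
  gs_inc : M -> gs_mid;
  gs_prj : gs_mid -> N;
  gs_proj : projective gs_mid;
  gs_se : short_exact gs_inc gs_prj;
  gs_ext : proj_extendable gs_inc }.

Record gp_class (X : rmodule R -> Prop) : Prop := GPClass {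
  gp_right : forall M, X M -> exists N, X N /\ inhabited (gp_step M N);
  gp_left : forall N, X N -> exists M, X M /\ inhabited (gp_step M N) }.

End ShortExact.

Arguments gs_inc {R M N} g _.
Arguments gs_prj {R M N} g _.
Arguments gs_proj {R M N} g.
Arguments gs_ext {R M N} g [Q] _ [f] _.

(** * Passage between two-sided complexes and classes closed under steps *)

Lemma int_chain (T : Type) (r : T -> T -> Prop) (x0 : T) :
  (forall x, exists y, r x y) -> (forall y, exists x, r x y) ->
  exists z : int -> T, z 0 = x0 /\ forall i, r (z i) (z (i + 1)).
Proof.
move=> /choice[f fP] /choice[g gP].
(* [Negz n] stands for -(n+1), hence [n.+1] iterations of [g]. *)
exists (fun i => match i with Posz n => iter n f x0 | Negz n => iter n.+1 g x0 end).
split=> // -[n|[|n]] /=.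
- by rewrite addn1; exact: fP.
- exact: gP.
by rewrite subn1; exact: gP.
Qed.

Section Characterization.
Variable R : pzRingType.

Lemma int_pred (i : int) : exists j, i = j + 1.
Proof. by exists (i - 1); rewrite subrK. Qed.

(** The class consists of all modules isomorphic to the kernel of some differential; each
    differential, corestricted to the next kernel, provides the projection of a step. *)
Lemma gorenstein_projective_class (G : rmodule R) :
  gorenstein_projective G -> exists X, gp_class X /\ X G.
Proof.
case=> P [d [Pp [dh [dex [dhom [io [ioh [ioinj ioex]]]]]]]].
pose cyc (M : rmodule R) i (io : M -> P i) :=
  [/\ is_rhom io, injective io & forall y, d i y = 0 <-> exists x, io x = y].
exists (fun M : rmodule R => exists i (io : M -> P i), cyc M i io); split; last by exists 0, io.
have ker_cyc i : cyc (ker_mod (dh i)) i (@ker_val _ _ _ _).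
  split=> //; first exact: ker_val_inj.
  move=> y; split=> [e|[x <-]]; last exact: ker_valP.
  by exists (ker_mk (dh i).1 e).
have ext (M : rmodule R) i (j : M -> P i) : cyc M i j -> proj_extendable j.
  (* With [i] written as [k + 1 + 1], [M] is the image of [d (k + 1)], whose corestriction is [c].
     The map [f] after [c] kills the image of [d k], so Hom-exactness factors it through
     [d (k + 1)]. *)
  move: j; have [i1 ->] := int_pred i; have [k ->] := int_pred i1 => j.
  case=> jh jinj jex Q Qp f fh.
  have /choice[c cE] y : exists m, j m = d (k + 1) y.
    by apply/jex/dex; exists y.
  have ch : is_rhom c.
    by split=> *; apply: jinj; rewrite (jh.1, jh.2) !cE ((dh _).1, (dh _).2).
  have [|g [gh ge]] := dhom Q Qp k _ (rhom_comp ch fh).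
    move=> x; suff -> : c (d k x) = 0 by rewrite (rhom0 fh).
    by apply: jinj; rewrite cE (rhom0 jh); apply/dex; exists x.
  exists g; split=> // m.
  have /dex [y e] : d (k + 1 + 1) (j m) = 0 by apply/jex; exists m.
  by rewrite -e ge; congr f; apply: jinj; rewrite cE.
have step i (M N : rmodule R) (j : M -> P i) (j' : N -> P (i + 1)) :
    cyc M i j -> cyc N (i + 1) j' -> inhabited (gp_step M N).
  move=> cj [jh' jinj' jex']; have [jh jinj jex] := cj.
  have /choice[p pE] x : exists y, j' y = d i x.
    by apply/jex'/dex; exists x.
  have ph : is_rhom p.
    by split=> *; apply: jinj'; rewrite (jh'.1, jh'.2) !pE ((dh _).1, (dh _).2).
  have se : short_exact j p.
    split=> //.
      move=> y; have /dex [x e] : d (i + 1) (j' y) = 0 by apply/jex'; exists y.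
      by exists x; apply: jinj'; rewrite pE.
    move=> x; rewrite -jex -pE; split=> [->|e]; first exact: rhom0.
    by apply: jinj'; rewrite e (rhom0 jh').
  by constructor; exact: GPStep (Pp i) se (ext _ _ _ cj).
split=> M [i [j cj]].
  exists (ker_mod (dh (i + 1))); split; first by exists (i + 1), (@ker_val _ _ _ _).
  exact: step cj (ker_cyc _).
have [k e] := int_pred i; move: j cj; rewrite e => j cj.
exists (ker_mod (dh k)); split; first by exists k, (@ker_val _ _ _ _).
exact: step (ker_cyc _) cj.
Qed.

(** Steps are chained in both directions and spliced: a differential is the projection onto the next
    member followed by the inclusion of that member in its own middle term. *)
Lemma class_gorenstein_projective (X : rmodule R -> Prop) (G : rmodule R) :
  gp_class X -> X G -> gorenstein_projective G.
Proof.
move=> [Xr Xl] XG.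
pose r (M N : {M | X M}) := inhabited (gp_step (sval M) (sval N)).
have [||z [z0 zr]] := @int_chain _ r (exist _ G XG).
- by case=> M XM; have [N [XN st]] := Xr M XM; exists (exist _ N XN).
- by case=> N XN; have [M [XM st]] := Xl N XN; exists (exist _ M XM).
have {}z0 : sval (z 0) = G by rewrite z0.
have st i : gp_step (sval (z i)) (sval (z (i + 1))).
  have /cid[] // : exists _ : gp_step (sval (z i)) (sval (z (i + 1))), True.
  by have [s] := zr i; exists s.
pose se i := gs_se (st i).
pose d i (x : gs_mid (st i)) := gs_inc (st (i + 1)) (gs_prj (st i) x).
have d0 i x : d i x = 0 <-> exists m, gs_inc (st i) m = x.
  rewrite -(se_exact (se i)); split=> [e|e].
    by apply: (se_inj (se (i + 1))); rewrite (rhom0 (se_rhomi (se _))).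
  by rewrite /d e (rhom0 (se_rhomi (se _))).
exists (fun i => gs_mid (st i)), d; split; [|split; [|split; [|split]]].
- by move=> i; exact: gs_proj.
- by move=> i; exact: rhom_comp (se_rhomp (se i)) (se_rhomi (se _)).
- move=> i y; rewrite d0; split=> [[m <-]|[x <-]]; last by eexists.
  by have [x <-] := se_surj (se i) m; exists x.
(* The image of [d i] is the kernel of the projection of step [i + 1], so [f] descends along that
   projection; the extension property of the following step then applies. *)
- move=> Q Qp i f fh fd0.
  have [|g [gh gE]] := se_descend (se (i + 1)) fh.
    by move=> m; have [x <-] := se_surj (se i) m; exact: fd0.
  have [h [hh hE]] := gs_ext (st (i + 1 + 1)) Qp gh.
  by exists h; split=> // y; rewrite hE gE.
rewrite -z0; exists (gs_inc (st 0)); split; first exact: se_rhomi (se 0).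
by split; [exact: se_inj (se 0) | exact: d0].
Qed.
End Characterization.

(** * Schanuel-type arguments for stable retracts *)

Section StableRetract.
Variable R : pzRingType.
Implicit Types M N Z W D K L P : rmodule R.

(* Equivalently, M is a direct summand of N (+) P with P projective. *)
Definition stable_retract M N : Prop :=
  exists P (u : M -> N) (v : N -> M) (a : M -> P) (b : P -> M),
    [/\ projective P, is_rhom u, is_rhom v, is_rhom a & is_rhom b] /\
    forall m, v (u m) + b (a m) = m.

Lemma stable_retract_refl M P : projective P -> stable_retract M M.
Proof.
move=> Pp; exists P, id, id, (fun _ => 0), (fun _ => 0).
split; last by move=> m; rewrite addr0.
by split=> //; exact: rhom_zero.
Qed.

(** Extendability of both inclusions spreads [u], [v] and [a] to the middle terms, and the first two
    induce maps [u'], [v'] of cokernels. The defect of the retraction on [D] vanishes on [W], so it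
    factors through [L] and shows that the identity of [L] differs from [v' u'] by a map through
    [D]. *)
Lemma stable_retract_cokernel Z Z' W D L (s : gp_step Z Z')
    (j : W -> D) (q : D -> L) :
  projective D -> short_exact j q -> proj_extendable j ->
  stable_retract W Z -> stable_retract L Z'.
Proof.
move=> Dp se jext [P [u [v [a [b [[Pp uh vh ah bh] e]]]]]].
have [jh qh] := (se_rhomi se, se_rhomp se).
have [ih ph] := (se_rhomi (gs_se s), se_rhomp (gs_se s)).
have [U [Uh UE]] := jext _ (gs_proj s) _ (rhom_comp uh ih).
have [V [Vh VE]] := gs_ext s Dp (rhom_comp vh jh).
have [a' [ah' aE]] := jext _ Pp _ ah.
have [|u' [uh' uE]] := se_descend se (rhom_comp Uh ph).
  by move=> m; rewrite UE (se_comp0 _ (gs_se s)).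
have [|v' [vh' vE]] := se_descend (gs_se s) (rhom_comp Vh qh).
  by move=> m; rewrite VE (se_comp0 _ se).
have ch : is_rhom (fun t => t - (V (U t) + j (b (a' t)))).
  apply: rhom_sub; first exact: rhom_id.
  apply: rhom_add; first exact: rhom_comp.
  by apply: rhom_comp jh; exact: rhom_comp.
have [|c [ch' cE]] := se_descend se ch.
  by move=> m; rewrite UE VE aE -jh.1 e subrr.
exists D, u', v', c, q; split=> // n; have [t <-] := se_surj se n.
rewrite cE (rhomB _ _ qh) qh.1 (se_comp0 _ se) addr0 uE vE.
by rewrite addrC subrK.
Qed.

(** Dually, [u], [v] and [b] are lifted using projectivity of the middle terms and of [P], and the
    defect on [D] lands in [K]. Extendability needs no assumption on [j]: it is inherited from [s]
    through the retraction. *)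
Lemma stable_retract_kernel Z Z' W D K (s : gp_step Z Z')
    (j : K -> D) (q : D -> W) :
  projective D -> short_exact j q -> stable_retract W Z' ->
  stable_retract K Z /\ proj_extendable j.
Proof.
move=> Dp se [P [u [v [a [b [[Pp uh vh ah bh] e]]]]]].
have [jh qh] := (se_rhomi se, se_rhomp se).
have [ih ph] := (se_rhomi (gs_se s), se_rhomp (gs_se s)).
have [U [Uh UE]] := Dp _ _ _ _ ph (se_surj (gs_se s)) (rhom_comp qh uh).
have [V [Vh VE]] := gs_proj s _ _ _ _ qh (se_surj se) (rhom_comp ph vh).
have [b' [bh' bE]] := Pp _ _ _ _ qh (se_surj se) bh.
have [|u' [uh' uE]] := se_lift (gs_se s) (rhom_comp jh Uh).
  by move=> k; rewrite UE (se_comp0 _ se) (rhom0 uh).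
have [|v' [vh' vE]] := se_lift se (rhom_comp ih Vh).
  by move=> z; rewrite VE (se_comp0 _ (gs_se s)) (rhom0 vh).
have ch : is_rhom (fun t => t - (V (U t) + b' (a (q t)))).
  apply: rhom_sub; first exact: rhom_id.
  apply: rhom_add; first exact: rhom_comp.
  by apply: rhom_comp bh'; exact: rhom_comp.
have [|c [ch' cE]] := se_lift se ch.
  by move=> t; rewrite (rhomB _ _ qh) qh.1 VE UE bE e subrr.
have eK k : v' (u' k) + c (j k) = k.
  apply: (se_inj se); rewrite jh.1 cE (se_comp0 _ se) (rhom0 ah) (rhom0 bh').
  by rewrite vE uE addr0 addrC subrK.
split; first by exists D, u', v', j, c.
move=> Q Qp f fh.
have [h [hh hE]] := gs_ext s Qp (rhom_comp vh' fh).
(* Along [j], the first term restricts to [f v' u'] and the second to [f c j]; these add up to [f]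
   by [eK]. *)
exists (fun t => h (U t) + f (c t)); split.
  by apply: rhom_add; exact: rhom_comp.
by move=> k; rewrite -uE hE -fh.1 eK.
Qed.
End StableRetract.

(** * Coinduction along a Frobenius extension and its two adjunctions with restriction *)

Section FrobeniusExtension.
Variables (S A : pzRingType) (l : {rmorphism S -> A}).
Variables (E : A -> S) (n : nat) (x y : 'I_n -> A).
Hypothesis ED : forall a b, E (a + b) = E a + E b.
Hypothesis EZl : forall s a, E (l s * a) = s * E a.
Hypothesis EZr : forall a s, E (a * l s) = E a * s.
Hypothesis xE : forall a, \sum_(i < n) x i * l (E (y i * a)) = a.
Hypothesis Ey : forall a, \sum_(i < n) l (E (a * x i)) * y i = a.

Lemma rhom_restrict (M N : rmodule A) (f : M -> N) :
  is_rhom f -> is_rhom (f : restrict l M -> restrict l N).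
Proof. by case=> fD fZ; split=> // m s; exact: fZ. Qed.

Section Coinduction.
Variable Q : rmodule S.

Definition rlin (phi : A -> Q) : Prop :=
  (forall a b, phi (a + b) = phi a + phi b) /\
  (forall a s, phi (a * l s) = rm_act Q (phi a) s).

(** By [xE], the elements [x i] and the functionals E(y i * -) form a dual basis of A as a right
    S-module. *)
Lemma rlin_expand phi b : rlin phi ->
  \sum_i rm_act Q (phi (x i)) (E (y i * b)) = phi b.
Proof.
case=> pD pZ.
have p0 : phi 0 = 0 by apply: (@addIr _ (phi 0)); rewrite -pD !add0r.
by rewrite -[b in RHS]xE (big_morph phi pD p0); apply: eq_bigr => i _; rewrite pZ.
Qed.

Lemma rlin_comb (w : 'I_n -> Q) : rlin (fun a => \sum_i rm_act Q (w i) (E (y i * a))).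
Proof.
split=> [a b|a s].
  by rewrite -big_split; apply: eq_bigr => i _; rewrite mulrDr ED rm_actDr.
by rewrite act_suml; apply: eq_bigr => i _; rewrite mulrA EZr rm_actM.
Qed.

(* A map phi in Hom_S(A, Q) is encoded by its values at the x i, which determine
   it by rlin_expand; coind_defect vanishes exactly on the tuples so obtained. *)
Definition coind_defect (v : {ffun 'I_n -> Q}) : {ffun 'I_n -> Q} :=
  v - [ffun j => \sum_i rm_act Q (v i) (E (y i * x j))].

Lemma coind_defectD v w : coind_defect (v + w) = coind_defect v + coind_defect w.
Proof.
rewrite /coind_defect addrACA -opprD; congr (_ - _); apply/ffunP=> j.
rewrite !ffunE -big_split; apply: eq_bigr => i _.
by rewrite ffunE rm_actDl.
Qed.

Definition coind_zmod := ker_zmod coind_defectD.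

(** The value at [a] of the S-linear map A -> Q encoded by [v]. *)
Definition coev (v : coind_zmod) (a : A) : Q :=
  \sum_i rm_act Q (ker_val v i) (E (y i * a)).

Lemma coev_rlin v : rlin (coev v).
Proof. exact: rlin_comb. Qed.

Lemma coev_inj v w : coev v =1 coev w -> v = w.
Proof.
have val_coev (u : coind_zmod) j : ker_val u j = coev u (x j).
  have /ffunP/(_ j)/eqP := ker_valP u.
  by rewrite !ffunE subr_eq0 => /eqP.
by move=> vw; apply: ker_val_inj; apply/ffunP=> j; rewrite !val_coev.
Qed.

Lemma coevD v w a : coev (v + w) a = coev v a + coev w a.
Proof.
by rewrite -big_split; apply: eq_bigr => i _; rewrite ker_valD ffunE rm_actDl.
Qed.

Fact coind_mkP phi : rlin phi -> coind_defect [ffun j => phi (x j)] = 0.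
Proof.
move=> pl; apply/ffunP=> j; rewrite !ffunE -(rlin_expand _ pl).
by apply/eqP; rewrite subr_eq0; apply/eqP; apply: eq_bigr => i _; rewrite ffunE.
Qed.

Definition coind_mk phi (pl : rlin phi) : coind_zmod :=
  ker_mk coind_defectD (coind_mkP pl).

Lemma coind_mkE phi (pl : rlin phi) a : coev (coind_mk pl) a = phi a.
Proof.
by rewrite -(rlin_expand a pl); apply: eq_bigr => i _; rewrite /ker_val /= ffunE.
Qed.

Fact coind_act_rlin v a : rlin (fun b => coev v (a * b)).
Proof.
have [vD vZ] := coev_rlin v.
by split=> *; rewrite (mulrDr, mulrA) (vD, vZ).
Qed.

Definition coind_act v a := coind_mk (coind_act_rlin v a).

Fact coind_act1 v : coind_act v 1 = v.
Proof. by apply: coev_inj => b; rewrite coind_mkE mul1r. Qed.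
Fact coind_actM v a b : coind_act v (a * b) = coind_act (coind_act v a) b.
Proof. by apply: coev_inj => c; rewrite !coind_mkE mulrA. Qed.
Fact coind_actDl v w a : coind_act (v + w) a = coind_act v a + coind_act w a.
Proof. by apply: coev_inj => b; rewrite coevD !coind_mkE coevD. Qed.
Fact coind_actDr v a b : coind_act v (a + b) = coind_act v a + coind_act v b.
Proof.
by apply: coev_inj => c; rewrite coevD !coind_mkE mulrDl (coev_rlin v).1.
Qed.

Definition coind : rmodule A := RModule coind_act1 coind_actM coind_actDl coind_actDr.

Lemma coev_act (v : coind) a b : coev (rm_act coind v a) b = coev v (a * b).
Proof. exact: coind_mkE. Qed.

Lemma coev_sum (I : finType) (F : I -> coind) b :
  coev (\sum_i F i) b = \sum_i coev (F i) b.
Proof.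
apply: (big_morph (fun v : coind => coev v b) (fun v w => coevD v w b)).
by apply: (@addIr _ (coev (0 : coind) b)); rewrite -coevD !add0r.
Qed.

(** Counit of the adjunction in which [coind] is right adjoint to restriction. *)
Definition coind_ev (v : restrict l coind) : Q := coev v 1.

Lemma rhom_coind_ev : is_rhom coind_ev.
Proof.
split=> [v w|v s]; first exact: coevD.
by rewrite /coind_ev coev_act mulr1 -[l s]mul1r (coev_rlin v).2.
Qed.

Lemma coind_right_adjoint (N : rmodule A) (f : restrict l N -> Q) : is_rhom f ->
  exists g : N -> coind, is_rhom g /\ forall m a, coev (g m) a = f (rm_act N m a).
Proof.
move=> fh.
have fl m : rlin (fun a => f (rm_act N m a)).
  by split=> [a b|a s]; [rewrite rm_actDr fh.1 | rewrite rm_actM -fh.2].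
exists (fun m => coind_mk (fl m)); split=> [|m a]; last exact: coind_mkE.
split=> [m m'|m a]; apply: coev_inj => b.
  by rewrite coevD !coind_mkE rm_actDl fh.1.
by rewrite coev_act !coind_mkE rm_actM.
Qed.

Lemma coind_ev_inj (N : rmodule A) (g h : N -> coind) : is_rhom g -> is_rhom h ->
  (forall m, coind_ev (g m) = coind_ev (h m)) -> g =1 h.
Proof.
move=> gh hh e m; apply: coev_inj => a.
by have := e (rm_act N m a); rewrite gh.2 hh.2 /coind_ev !coev_act mulr1.
Qed.

Fact coind_unit_rlin q : rlin (fun a => rm_act Q q (E a)).
Proof. by split=> *; rewrite (ED, EZr) (rm_actDr, rm_actM). Qed.

(** Unit of the adjunction in which [coind] is left adjoint to restriction. Under the Frobenius
    isomorphism of Hom_S(A, Q) with the tensor product of Q and A over S, it sends q to q (x) 1. *)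
Definition coind_unit (q : Q) : restrict l coind := coind_mk (coind_unit_rlin q).

Lemma coev_unit q a : coev (coind_unit q) a = rm_act Q q (E a).
Proof. exact: coind_mkE. Qed.

Lemma rhom_coind_unit : is_rhom coind_unit.
Proof.
split=> [q q'|q s]; apply: coev_inj => a.
  by rewrite coevD !coev_unit rm_actDl.
by rewrite coev_act !coev_unit EZl rm_actM.
Qed.

Lemma coind_unit_gen (v : coind) :
  v = \sum_i rm_act coind (coind_unit (coev v (x i))) (y i).
Proof.
apply: coev_inj => b; rewrite coev_sum -(rlin_expand b (coev_rlin v)).
by apply: eq_bigr => i _; rewrite coev_act coev_unit.
Qed.

Lemma coind_left_adjoint (N : rmodule A) (f : Q -> restrict l N) : is_rhom f ->
  exists g : coind -> N, is_rhom g /\ forall q, g (coind_unit q) = f q.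
Proof.
(* The witness is forced by [coind_unit_gen]. *)
move=> fh; exists (fun v => \sum_i rm_act N (f (coev v (x i))) (y i)).
split; first split=> [v w|v a].
- by rewrite -big_split; apply: eq_bigr => i _; rewrite coevD fh.1 rm_actDl.
- rewrite act_suml.
  (* The value of [v] at [a * x k] is expanded in the dual basis; summing over [k] first, [Ey] then
     reassembles [y i * a]. *)
  transitivity (\sum_i \sum_k
      rm_act N (f (rm_act Q (coev v (x i)) (E (y i * (a * x k))))) (y k)).
    rewrite exchange_big; apply: eq_bigr => k _ /=.
    rewrite coev_act -(rlin_expand _ (coev_rlin v)) (rhom_sum _ fh).
    exact: (@act_suml _ N).
  apply: eq_bigr => i _; rewrite -rm_actM -[y i * a]Ey act_sumr.
  by apply: eq_bigr => k _; rewrite fh.2 rm_actM mulrA.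
move=> q; rewrite -[RHS](@rm_act1 _ N) -[1 in RHS]Ey act_sumr.
by apply: eq_bigr => i _; rewrite coev_unit fh.2 rm_actM mul1r.
Qed.

Lemma coind_unit_epi (N : rmodule A) (g h : coind -> N) : is_rhom g -> is_rhom h ->
  (forall q, g (coind_unit q) = h (coind_unit q)) -> g =1 h.
Proof.
move=> gh hh e v; rewrite [v]coind_unit_gen !rhom_sum //.
by apply: eq_bigr => i _; rewrite gh.2 hh.2 e.
Qed.

(** A left adjoint of restriction, which preserves surjections, preserves projectives. *)
Lemma projective_coind : projective Q -> projective coind.
Proof.
move=> Qp N N' g f gh gsurj fh.
have [h [hh hE]] := Qp (restrict l N) (restrict l N') g _ (rhom_restrict gh) gsurj
  (rhom_comp rhom_coind_unit (rhom_restrict fh)).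
have [k [kh kE]] := coind_left_adjoint hh; exists k; split=> //.
by apply: coind_unit_epi => // [|q]; [exact: rhom_comp | rewrite kE hE].
Qed.

End Coinduction.

(** * Restriction of projectives, of steps and of Gorenstein projectives *)

Lemma projective_restrict (T : rmodule A) : projective T -> projective (restrict l T).
Proof.
move=> Tp N N' g f gh gsurj fh.
have [f' [fh' fE]] := coind_right_adjoint fh.
have [g' [gh' gE]] := coind_right_adjoint (rhom_comp (rhom_coind_ev N) gh).
have {}gE v a : coev (g' v) a = g (coev v a).
  by rewrite gE /coind_ev coev_act mulr1.
(* Coinduction preserves surjections: preimages of the values at the [x i] are combined into an
   S-linear map by the dual basis. *)
have gsurj' v : exists w, g' w = v.
  have /choice [w wE] a : exists z, g z = coev v a by exact: gsurj.
  exists (coind_mk (rlin_comb (fun i => w (x i)))); apply: coev_inj => a.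
  rewrite gE coind_mkE (rhom_sum _ gh) -(rlin_expand a (coev_rlin v)).
  by apply: eq_bigr => i _; rewrite gh.2 wE.
have [h [hh hE]] := Tp _ _ _ _ gh' gsurj' fh'.
exists (fun t => coind_ev (h t)); split.
  exact: (rhom_comp (rhom_restrict hh) (rhom_coind_ev N)).
by move=> t; rewrite /coind_ev -gE hE fE rm_act1.
Qed.

Lemma short_exact_restrict (M T N : rmodule A) (i : M -> T) (p : T -> N) :
  short_exact i p ->
  short_exact (i : restrict l M -> restrict l T) (p : restrict l T -> restrict l N).
Proof. by case=> ih ph *; split=> //; exact: rhom_restrict. Qed.

Lemma proj_extendable_restrict (M T : rmodule A) (i : M -> T) : is_rhom i ->
  proj_extendable i -> proj_extendable (i : restrict l M -> restrict l T).
Proof.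
move=> ih iext Q Qp f fh.
have [f' [fh' fE]] := coind_right_adjoint fh.
have [g [gh gE]] := iext _ (projective_coind Qp) _ fh'.
exists (fun t => coind_ev (g t)); split.
  exact: (rhom_comp (rhom_restrict gh) (rhom_coind_ev Q)).
by move=> m; rewrite gE /coind_ev fE rm_act1.
Qed.

(* A projective Q is a direct summand of coind (restrict l Q). *)
Lemma proj_extendable_of_restrict (M T : rmodule A) (i : M -> T) : is_rhom i ->
  proj_extendable (i : restrict l M -> restrict l T) -> proj_extendable i.
Proof.
move=> ih iext Q Qp f fh.
have [e [eh eE]] := @coind_left_adjoint (restrict l Q) Q id (rhom_id _).
have esurj q : exists v, e v = q by exists (coind_unit (q : restrict l Q)).
have [s [sh sE]] := Qp _ _ _ _ eh esurj (rhom_id Q).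
have sfh := rhom_comp fh sh.
(* The evaluation of [s] after [f] extends over S to [F]. Its transpose [F'], composed with [i], has
   the same evaluation as [s] after [f], hence equals it, and [e] undoes [s]. *)
have [F [Fh FE]] := iext _ (projective_restrict Qp) _
  (rhom_comp (rhom_restrict sfh) (rhom_coind_ev (restrict l Q))).
have [F' [Fh' FE']] := coind_right_adjoint Fh.
exists (fun t => e (F' t)); split; first exact: rhom_comp.
move=> m; rewrite -[RHS]sE; congr e; move: m.
apply: coind_ev_inj => // [|m]; first exact: rhom_comp.
by rewrite {1}/coind_ev FE' rm_act1 FE.
Qed.

Lemma gorenstein_projective_restrict (M : rmodule A) :
  gorenstein_projective M -> gorenstein_projective (restrict l M).
Proof.
case/gorenstein_projective_class=> X [[Xr Xl] XM].
have step (N N' : rmodule A) :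
    gp_step N N' -> gp_step (restrict l N) (restrict l N').
  case=> T i p Tp se iext.
  exact: GPStep (projective_restrict Tp) (short_exact_restrict se)
    (proj_extendable_restrict (se_rhomi se) iext).
apply: (@class_gorenstein_projective _
  (fun N => exists N', X N' /\ N = restrict l N')); last by exists M.
split=> _ [N [XN ->]].
  have [N' [XN' [s]]] := Xr N XN; exists (restrict l N').
  by split; [exists N' | constructor; exact: step].
have [N' [XN' [s]]] := Xl N XN; exists (restrict l N').
by split; [exists N' | constructor; exact: step].
Qed.

(** * Steps over A built from steps over S *)

Lemma gp_step_right (W : rmodule A) (Z Z' : rmodule S) :
  gp_step Z Z' -> stable_retract (restrict l W) Z ->
  exists L, stable_retract (restrict l L) Z' /\ inhabited (gp_step W L).
Proof.
move=> s WZ; have [P [u [v [a [b [[Pp uh vh ah bh] e]]]]]] := WZ.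
have ih := se_rhomi (gs_se s).
(* The retraction identity [e] makes [k] injective; its transpose [j] stays injective because
   evaluation recovers [k]. *)
pose k (w : restrict l W) : dsum (gs_mid s) P := (gs_inc s (u w), a w).
have kh : is_rhom k by apply: rhom_pair => //; exact: rhom_comp.
have Cp := projective_coind (projective_dsum (gs_proj s) Pp).
have [j [jh jE]] := coind_right_adjoint kh.
have {}jE w : coind_ev (j w) = k w by rewrite /coind_ev jE rm_act1.
have jinj : injective j.
  apply: rhom_inj => // w jw0.
  have [iu0 aw0] : k w = (0, 0) by rewrite -jE jw0 (rhom0 (rhom_coind_ev _)).
  have uw0 : u w = 0 by apply: (se_inj (gs_se s)); rewrite iu0 (rhom0 ih).
  by rewrite -[w]e uw0 aw0 (rhom0 vh) (rhom0 bh) addr0.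
have jext : proj_extendable (j : restrict l W -> restrict l (coind _)).
  move=> Q Qp f fh.
  have [h [hh hE]] := gs_ext s Qp (rhom_comp vh fh).
  (* On [k w] this gives [f (v (u w)) + f (b (a w))], which is [f w]. *)
  pose g (t : dsum (gs_mid s) P) := h t.1 + f (b t.2).
  have gh : is_rhom g := rhom_copair hh (rhom_comp bh fh).
  exists (fun t => g (coind_ev t)); split; first exact: rhom_comp (rhom_coind_ev _) gh.
  by move=> m; rewrite jE /g /k hE -fh.1 e.
have [L [q se]] := exists_cokernel jh jinj.
exists L; split; last first.
  by constructor; exact: GPStep Cp se (proj_extendable_of_restrict jh jext).
exact: (stable_retract_cokernel s (projective_restrict Cp)
  (short_exact_restrict se) jext WZ).
Qed.

Lemma gp_step_left (W : rmodule A) (Z Z' : rmodule S) :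
  gp_step Z Z' -> stable_retract (restrict l W) Z' ->
  exists K, stable_retract (restrict l K) Z /\ inhabited (gp_step K W).
Proof.
move=> s WZ; have [P [u [v [a [b [[Pp uh vh ah bh] e]]]]]] := WZ.
pose k (t : dsum (gs_mid s) P) : restrict l W := v (gs_prj s t.1) + b t.2.
have kh : is_rhom k := rhom_copair (rhom_comp (se_rhomp (gs_se s)) vh) bh.
have Cp := projective_coind (projective_dsum (gs_proj s) Pp).
have [q [qh qE]] := coind_left_adjoint kh.
have qsurj w : exists t, q t = w.
  have [t tE] := se_surj (gs_se s) (u w).
  (* With [t] lifting [u w], this is sent by [q] to [v (u w) + b (a w)], that is, to [w]. *)
  exists (coind_unit ((t, a w) : dsum _ _)).
  by rewrite qE /k tE; exact: e.
have [K [j se]] := exists_kernel qh qsurj.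
have [KZ jext] := stable_retract_kernel s (projective_restrict Cp)
  (short_exact_restrict se) WZ.
exists K; split=> //; constructor.
exact: GPStep Cp se (proj_extendable_of_restrict (se_rhomi se) jext).
Qed.

Lemma gorenstein_projective_of_restrict (M : rmodule A) :
  gorenstein_projective (restrict l M) -> gorenstein_projective M.
Proof.
case/gorenstein_projective_class=> X [[Xr Xl] XM].
apply: (@class_gorenstein_projective _
  (fun W => exists Z, X Z /\ stable_retract (restrict l W) Z)); last first.
  (* The step is used only for its middle term, a projective needed to present the restriction of
     [M] as a stable retract of itself. *)
  have [N [_ [s]]] := Xr _ XM; exists (restrict l M).
  by split=> //; exact: stable_retract_refl (gs_proj s).
split=> W [Z [XZ WZ]].
  have [Z' [XZ' [s]]] := Xr Z XZ; have [L [LZ' sL]] := gp_step_right s WZ.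
  by exists L; split=> //; exists Z'.
have [Z' [XZ' [s]]] := Xl Z XZ; have [K [KZ' sK]] := gp_step_left s WZ.
by exists K; split=> //; exists Z'.
Qed.

End FrobeniusExtension.

Theorem theorem3p2 (S A : pzRingType) (l : {rmorphism S -> A}) (M : rmodule A) :
  frobenius_ext l ->
  (gorenstein_projective M <-> gorenstein_projective (restrict l M)).
Proof.
case=> E [n [x [y [ED [EZl [EZr [xE Ey]]]]]]].
by split; [exact: (@gorenstein_projective_restrict S A l E n x y)
  | exact: (@gorenstein_projective_of_restrict S A l E n x y)].
Qed.
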